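(* Let $E$ be a measurable space endowed with a countably generated $\sigma$-field $\mathcal E$, let $V:E\to(0,+\infty)$ be a measurable function, and let $P$ be a (non-negative) kernel on $E$ defining a bounded operator on $L^\infty(V)$. Assume that there exists a measurable set $E_K\subset E$ such that: (1) there exists $\theta_1\in(0,r(P))$ such that $PV(x)\le\theta_1V(x)$ for all $x\in E\setminus E_K$; (2) there exist $\theta_2\in(0,r(P))$ and a positive compact operator $K$ on $L^\infty(V)$ such that $$0\le Pf(x)\le Kf(x)+\theta_2V(x)\|f\|_V,\qquad\forall x\in E_K,\ \forall f\in L^\infty(V)\text{ with }f\ge0.$$ Then the operator $P$ is quasi-compact in $L^\infty(V)$, with $r_{\mathrm{ess}}(P)\le\max(\theta_1,\theta_2)$.
   Context: $L^\infty(V)$ is the space of measurable functions $f:E\to\mathbb C$ for which there is $C>0$ with $|f(x)|\le C\,V(x)$ for all $x\in E$, endowed with the norm $\|f\|_V=\sup_{x\in E}|f(x)|/V(x)$. A kernel $P$ on $E$ is a family $P(x,\cdot)$, $x\in E$, of $\sigma$-finite measures such that $x\mapsto P(x,A)$ is measurable for every $A\in\mathcal E$; $Pf(x)=\int_E f(y)P(x,\mathrm dy)$. A linear operator $Q$ on $L^\infty(V)$ is positive if $Qf\ge0$ for all $f\ge0$. For a bounded operator $Q$ on $B=L^\infty(V)$, $r(Q)$ is its spectral radius, $\|Q\|$ its operator norm, and its essential spectral radius is $$r_{\mathrm{ess}}(Q):=\lim_{n\to\infty}\inf\{\|Q^n-K\|^{1/n}:K\in\mathcal K(B)\},$$ where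 $\mathcal K(B)$ is the set of compact operators on $B$. $Q$ is quasi-compact if $r_{\mathrm{ess}}(Q)<r(Q)$. *)

(* Defs.v *)
From HB Require Import structures.
From mathcomp Require Import all_boot all_order all_algebra.
From mathcomp Require Import complex.
From mathcomp Require Import all_classical all_reals all_analysis.
From mathcomp Require Import measurable_realfun.
Set Implicit Arguments.
Unset Strict Implicit.
Unset Printing Implicit Defensive.
Import Order.TTheory GRing.Theory Num.Theory.
Import numFieldTopology.Exports numFieldNormedType.Exports.
Import ComplexField ComplexField.Normc.
Local Open Scope classical_set_scope.
Local Open Scope ring_scope.
Local Open Scope complex_scope.

Section bounded_operators.
Context {R : realType} {B : normedModType R[i]}.
Implicit Types Q K : {linear B -> B}.

Definition bounded_op Q := bounded_near Q (nbhs (0 : B)).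

(* The norm of B has values in R[i]; its imaginary part is zero. *)
Definition opnorm (F : B -> B) : R :=
  sup [set complex.Re `|F f| | f in [set f : B | `|f| <= 1]].

Definition compact_op K :=
  forall A : set B, bounded_set A -> precompact (K @` A).

Definition spectrum Q : set R[i] := [set l |
  ~ exists S : {linear B -> B},
      [/\ bounded_op S, cancel (fun f => l *: f - Q f) S
        & cancel S (fun f => l *: f - Q f)]].

Definition spectral_radius Q : R := sup [set normc l | l in spectrum Q].

Definition ess_spectral_radius Q : R :=
  limn (fun n : nat =>
    inf [set opnorm (fun f => iter n Q f - K f) `^ (n%:R^-1)
        | K in [set K : {linear B -> B} | compact_op K]]).

Definition quasi_compact Q := ess_spectral_radius Q < spectral_radius Q.

End bounded_operators.

Definition countably_generated d (E : measurableType d) :=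
  exists G : set (set E), countable G /\ d.-measurable = <<s G >>.

Section weighted_Linfty.
Context {d : measure_display} {E : measurableType d} {R : realType}.
Implicit Types V : E -> {posnum R}.

Definition Linfty_pred V : {pred E -> R[i]} := mem [set f : E -> R[i] |
  [/\ measurable_fun [set: E] (fun x => complex.Re (f x)),
      measurable_fun [set: E] (fun x => complex.Im (f x))
    & exists2 C : R, 0 < C & forall x, normc (f x) <= C * (V x)%:num]].

Record Linfty V := MkLinfty {
  Linfty_fun :> E -> R[i];
  LinftyP : Linfty_fun \in Linfty_pred V }.

HB.instance Definition _ V := [isSub for @Linfty_fun V].
HB.instance Definition _ V := [Choice of Linfty V by <:].

Lemma normc_ge0 (z : R[i]) : 0 <= normc z.
Proof. by case: z => a b; exact: sqrtr_ge0. Qed.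

Lemma Linfty_submod_closed V : submod_closed (Linfty_pred V).
Proof.
split.
  rewrite inE; split; [exact: measurable_cst|exact: measurable_cst|].
  by exists 1 => // x; rewrite [normc _]normc0 mul1r ltW.
move=> a f g; rewrite !inE => -[mf1 mf2 [C C0 fC]] [mg1 mg2 [D D0 gD]].
split.
- rewrite (_ : (fun x => _) =
    (fun x => complex.Re a * complex.Re (f x)
              - complex.Im a * complex.Im (f x) + complex.Re (g x))); last first.
    apply/funext => x; rewrite -[(a *: f + g) x]/(a * f x + g x).
    by case: a (f x) (g x) => ? ? [? ?] [? ?].
  by apply: measurable_funD => //; apply: measurable_funB => //; exact: measurable_funM.
- rewrite (_ : (fun x => _) =
    (fun x => complex.Re a * complex.Im (f x)
              + complex.Im a * complex.Re (f x) + complex.Im (g x))); last first.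
    apply/funext => x; rewrite -[(a *: f + g) x]/(a * f x + g x).
    by case: a (f x) (g x) => ? ? [? ?] [? ?].
  by apply: measurable_funD => //; apply: measurable_funD => //; exact: measurable_funM.
- exists (normc a * C + D).
    by rewrite ltr_wpDl// mulr_ge0 ?normc_ge0// ltW.
  move=> x; rewrite (le_trans (le_normcD _ _))// mulrDl lerD//.
  by rewrite normcM -mulrA ler_wpM2l ?normc_ge0.
Qed.

HB.instance Definition _ V :=
  GRing.isSubmodClosed.Build _ _ (Linfty_pred V) (Linfty_submod_closed V).
HB.instance Definition _ V := [SubChoice_isSubLmodule of Linfty V by <:].


Definition Vnorm V (f : Linfty V) : R :=
  sup [set normc (f x) / (V x)%:num | x in [set: E]].

Lemma Vnorm_has_sup V (f : Linfty V) :
  has_sup [set normc (f x) / (V x)%:num | x in [set: E]].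
Proof.
split; first by exists (normc (f point) / (V point)%:num), point.
have := LinftyP f; rewrite inE => -[_ _ [C _ fC]].
by exists C => _ [x _ <-]; rewrite ler_pdivrMr.
Qed.

Lemma Vnorm_ub V (f : Linfty V) x : normc (f x) <= Vnorm f * (V x)%:num.
Proof.
by rewrite -ler_pdivrMr//; apply: sup_upper_bound; [exact: Vnorm_has_sup|exists x].
Qed.

Lemma Vnorm_le V (f : Linfty V) (C : R) :
  (forall x, normc (f x) <= C * (V x)%:num) -> Vnorm f <= C.
Proof.
move=> fC; apply: ge_sup; first by have [] := Vnorm_has_sup f.
by move=> _ [x _ <-]; rewrite ler_pdivrMr.
Qed.

Lemma Vnorm_ge0 V (f : Linfty V) : 0 <= Vnorm f.
Proof.
have := le_trans (normc_ge0 (f point)) (Vnorm_ub f point).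
by rewrite pmulr_lge0.
Qed.

Lemma Vnorm_triangle V (f g : Linfty V) :
  (Vnorm (f + g))%:C <= (Vnorm f)%:C + (Vnorm g)%:C.
Proof.
rewrite -rmorphD lecR; apply: Vnorm_le => x.
by rewrite (le_trans (le_normcD _ _))// mulrDl lerD// Vnorm_ub.
Qed.

Lemma VnormZ V (a : R[i]) (f : Linfty V) :
  (Vnorm (a *: f))%:C = `|a| * (Vnorm f)%:C.
Proof.
rewrite -[`|a|]/((normc a)%:C) -rmorphM; congr (_ %:C).
apply/eqP; rewrite eq_le; apply/andP; split.
  apply: Vnorm_le => x; rewrite [(a *: f) x]/(a * f x) normcM -mulrA.
  by rewrite ler_wpM2l ?normc_ge0// Vnorm_ub.
have [->|a0] := eqVneq a 0; first by rewrite normc0 mul0r Vnorm_ge0.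
have na0 : 0 < normc a.
  rewrite lt_neqAle normc_ge0 andbT eq_sym.
  by apply: contra a0 => /eqP/eq0_normc ->.
rewrite mulrC -ler_pdivlMr//; apply: Vnorm_le => x.
rewrite mulrAC ler_pdivlMr// mulrC -normcM; exact: (Vnorm_ub (a *: f)).
Qed.

Lemma Vnorm0_eq0 V (f : Linfty V) : (Vnorm f)%:C = 0 -> f = 0.
Proof.
move=> [f0]; apply/val_inj/funext => x /=; apply: eq0_normc.
apply/eqP; rewrite eq_le normc_ge0 andbT.
by rewrite (le_trans (Vnorm_ub f x))// f0 mul0r.
Qed.

HB.instance Definition _ V := Lmodule_isNormed.Build R[i] (Linfty V)
  (@Vnorm_triangle V) (@VnormZ V) (@Vnorm0_eq0 V).

Lemma Linfty_normE V (f : Linfty V) : `|f| = (Vnorm f)%:C.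
Proof. by []. Qed.

(* The order of R[i] is partial: 0 <= z means that z is real and nonnegative. *)
Definition positive_op V (Q : {linear Linfty V -> Linfty V}) :=
  forall f : Linfty V, (forall x, 0 <= f x) -> forall x, 0 <= Q f x.

Definition kernel_int (P : R.-sigmafker E ~> E) (f : E -> R[i]) (x : E) : R[i] :=
  \int[P x]_y complex.Re (f y) +i* \int[P x]_y complex.Im (f y).

(* P defines the operator T on Linfty V: every f in Linfty V is integrable
   with respect to every P x, and T f = Pf. *)
Definition kernel_op V (P : R.-sigmafker E ~> E)
    (T : {linear Linfty V -> Linfty V}) :=
  forall (f : Linfty V) x,
    [/\ (P x).-integrable setT (fun y => (complex.Re (f y))%:E),
        (P x).-integrable setT (fun y => (complex.Im (f y))%:E)
      & T f x = kernel_int P f x].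

End weighted_Linfty.

(* Main.v *)
(* After division by [V], [T] acts on bounded measurable real functions, and
   compactness of [K] (finitely many points of [E] nearly determine [K u] on the
   unit ball) gives a positive, merely finitely additive functional [phi] with
   [T u <= phi u + theta'] for [0 <= u <= 1], where [theta'] is arbitrarily
   close to [theta = max theta1 theta2].
   Given any other positive functional [lam], take a finite partition of unity
   [g] for which the [lam]-mean of the energy
   [sum_i phi (g i)^2 / (T (g i) x + phi (g i))] is almost maximal.  Refining it
   by [u] and [1 - u] hardly raises the energy, so that, in [lam]-mean and
   uniformly on the unit ball, [T] is close to [F + Q] with [F] of finite rank,
   [F u <= phi u], and [Q] positive of norm at most [theta'].
   Composing [n] operators [T - F], each [F] being chosen for the functional
   accumulated so far, differs from [T^n] by a finite rank operator and has norm
   at most [C tau^n], for any [tau > theta']. *)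
From HB Require Import structures.
Require Import Defs.
From mathcomp Require Import all_boot all_order all_algebra.
From mathcomp Require Import complex.
From mathcomp Require Import all_classical all_reals all_analysis.
From mathcomp Require Import measurable_realfun.
From mathcomp Require Import ring lra.
Set Implicit Arguments.
Unset Strict Implicit.
Unset Printing Implicit Defensive.
Import Order.TTheory GRing.Theory Num.Theory.
Import numFieldTopology.Exports numFieldNormedType.Exports.
Local Open Scope classical_set_scope.
Local Open Scope ring_scope.

(** * Positive functionals and operators on bounded measurable functions *)

Section bounded_measurable.
Context {d : measure_display} {E : measurableType d} {R : realType}.
Implicit Types (u v : E -> R) (phi lam : (E -> R) -> R)
  (T : (E -> R) -> E -> R) (I : finType).

Definition bmf u :=
  measurable_fun [set: E] u /\ exists M, forall x, `|u x| <= M.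

(** The laws are required only on bounded measurable functions, values elsewhere being arbitrary. No
    countable additivity is asked, since the compact operator need not come from a kernel. *)
Record posfun phi : Prop := PosFun {
  posfunD : forall u v, bmf u -> bmf v ->
    phi (fun x => u x + v x) = phi u + phi v;
  posfunZ : forall a u, bmf u -> phi (fun x => a * u x) = a * phi u;
  posfun_ge0 : forall u, bmf u -> (forall x, 0 <= u x) -> 0 <= phi u }.

Record posop T : Prop := PosOp {
  posop_bmf : forall u, bmf u -> bmf (T u);
  posop_fun : forall x, posfun (T^~ x) }.

Lemma bmf_cst a : bmf (fun=> a).
Proof. by split; [exact: measurable_cst | exists `|a|]. Qed.

Lemma bmfD u v : bmf u -> bmf v -> bmf (fun x => u x + v x).
Proof.
move=> [mu [M uM]] [mv [N vN]]; split; first exact: measurable_funD.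
by exists (M + N) => x; rewrite (le_trans (ler_normD _ _))// lerD.
Qed.

Lemma bmfM u v : bmf u -> bmf v -> bmf (fun x => u x * v x).
Proof.
move=> [mu [M uM]] [mv [N vN]]; split; first exact: measurable_funM.
by exists (M * N) => x; rewrite normrM ler_pM.
Qed.

Lemma bmfZ a u : bmf u -> bmf (fun x => a * u x).
Proof. by move=> bu; apply: bmfM => //; exact: bmf_cst. Qed.

Lemma bmfB u v : bmf u -> bmf v -> bmf (fun x => u x - v x).
Proof.
move=> bu bv; rewrite (_ : (fun x => _) = (fun x => u x + -1 * v x)).
  by apply: bmfD => //; exact: bmfZ.
by apply/funext => x; rewrite mulN1r.
Qed.

Lemma bmf_norm u : bmf u -> bmf (fun x => `|u x|).
Proof.
move=> [mu [M uM]]; split; last by exists M => x; rewrite normr_id.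
by apply: measurableT_comp => //; exact: normr_measurable.
Qed.

Lemma bmf_max u v : bmf u -> bmf v -> bmf (fun x => Num.max (u x) (v x)).
Proof.
move=> [mu [M uM]] [mv [N vN]]; split; first exact: measurable_maxr.
exists (M + N) => x; have M0 := le_trans (normr_ge0 _) (uM x).
have N0 := le_trans (normr_ge0 _) (vN x).
by case: (leP (u x) (v x)) => _; [rewrite (le_trans (vN x))// lerDr
                   | rewrite (le_trans (uM x))// lerDl].
Qed.

Lemma bmf_sum I (g : I -> E -> R) :
  (forall i, bmf (g i)) -> bmf (fun x => \sum_i g i x).
Proof.
move=> bg; elim: (index_enum I) => [|i s IH].
  under eq_fun do rewrite big_nil; exact: bmf_cst.
by under eq_fun do rewrite big_cons; exact: bmfD.
Qed.

Lemma measurable_inv u : (forall x, 0 <= u x) ->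
  measurable_fun [set: E] u -> measurable_fun [set: E] (fun x => (u x)^-1).
Proof.
move=> u0 mu; under eq_fun do rewrite -powR_inv1//.
by apply: (measurableT_comp (measurable_powR (-1))).
Qed.

(** As [x / 0 = 0], the bound by [M * v] keeps the quotient bounded even where [v] vanishes. *)
Lemma bmf_div u v M : bmf u -> bmf v -> (forall x, 0 <= v x) ->
  (forall x, `|u x| <= M * v x) -> bmf (fun x => u x / v x).
Proof.
move=> [mu _] [mv _] v0 uv; split.
  by apply: measurable_funM => //; exact: measurable_inv.
exists `|M| => x; rewrite normrM normfV (ger0_norm (v0 x)).
have [v0x|vx] := eqVneq (v x) 0.
  by rewrite v0x invr0 mulr0.
have {}vx : 0 < v x by rewrite lt_def vx v0.
rewrite ler_pdivrMr// (le_trans (uv x))// ler_wpM2r//.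
exact: ler_norm.
Qed.

Section posfun_theory.
Variables (phi : (E -> R) -> R) (pphi : posfun phi).

Lemma posfun0 : phi (fun=> 0) = 0.
Proof.
rewrite -[RHS](mul0r (phi (fun=> 0))) -posfunZ//; last exact: bmf_cst.
by congr phi; apply/funext => x; rewrite mulr0.
Qed.

Lemma posfun_sum I (g : I -> E -> R) : (forall i, bmf (g i)) ->
  phi (fun x => \sum_i g i x) = \sum_i phi (g i).
Proof.
move=> bg; suff [] : bmf (fun x => \sum_i g i x) /\
    phi (fun x => \sum_i g i x) = \sum_i phi (g i) by [].
elim: (index_enum I) => [|i s [bs IH]].
  under eq_fun do rewrite big_nil; rewrite big_nil posfun0.
  by split=> //; exact: bmf_cst.
under eq_fun do rewrite big_cons.
by rewrite big_cons posfunD// IH; split=> //; exact: bmfD.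
Qed.

Lemma posfunB u v : bmf u -> bmf v -> phi (fun x => u x - v x) = phi u - phi v.
Proof.
move=> bu bv; have -> : (fun x => u x - v x) = (fun x => u x + -1 * v x).
  by apply/funext => x; rewrite mulN1r.
by rewrite posfunD// ?posfunZ ?mulN1r//; exact: bmfZ.
Qed.

Lemma posfun_le u v : bmf u -> bmf v -> (forall x, u x <= v x) -> phi u <= phi v.
Proof.
move=> bu bv uv; rewrite -subr_ge0 -posfunB//; apply: posfun_ge0 => //.
  exact: bmfB.
by move=> x; rewrite subr_ge0.
Qed.

Lemma posfun_cst a : phi (fun=> a) = a * phi (fun=> 1).
Proof.
rewrite -posfunZ//; last exact: bmf_cst.
by congr phi; apply/funext => x; rewrite mulr1.
Qed.

Lemma posfun_norm u : bmf u -> `|phi u| <= phi (fun x => `|u x|).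
Proof.
move=> bu; have bn := bmf_norm bu; rewrite ler_norml; apply/andP; split.
  rewrite -mulN1r -posfunZ//; apply: posfun_le => //; first exact: bmfZ.
  by move=> x; rewrite mulN1r lerNl -normrN ler_norm.
by apply: posfun_le => // x; exact: ler_norm.
Qed.

Lemma posfun1_ge0 : 0 <= phi (fun=> 1).
Proof. by apply: posfun_ge0 => //; exact: bmf_cst. Qed.

Lemma posfun_le_cst u M : bmf u -> (forall x, u x <= M) ->
  phi u <= M * phi (fun=> 1).
Proof. by move=> bu uM; rewrite -posfun_cst posfun_le//; exact: bmf_cst. Qed.

Lemma posfun_bound u M : bmf u -> (forall x, `|u x| <= M) ->
  `|phi u| <= M * phi (fun=> 1).
Proof.
move=> bu uM; rewrite (le_trans (posfun_norm bu))// posfun_le_cst//.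
exact: bmf_norm.
Qed.

End posfun_theory.

Lemma posfun_axpy a phi lam : 0 <= a -> posfun phi -> posfun lam ->
  posfun (fun u => a * phi u + lam u).
Proof.
move=> a0 pphi plam; split=> [u v bu bv|b u bu|u bu u0].
- by rewrite !posfunD//; ring.
- by rewrite !posfunZ//; ring.
- by rewrite addr_ge0// ?mulr_ge0// posfun_ge0.
Qed.

Lemma posfun_comp lam T : posfun lam -> posop T -> posfun (fun u => lam (T u)).
Proof.
move=> plam pT; have bT := posop_bmf pT; split=> [u v bu bv|a u bu|u bu u0].
- rewrite -posfunD; [|by []|exact: bT..]; congr lam; apply/funext => x.
  exact: (posfunD (posop_fun pT x)).
- rewrite -posfunZ; [|by []|exact: bT]; congr lam; apply/funext => x.
  exact: (posfunZ (posop_fun pT x)).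
- by apply: posfun_ge0 (bT _ bu) _ => // x; apply: (posfun_ge0 (posop_fun pT x)).
Qed.

Lemma posop_iter T n : posop T -> posop (fun u => iter n T u).
Proof.
move=> pT; elim: n => [|n IH].
  by split=> // x; split=> //.
split=> [u bu|x]; first by apply: (posop_bmf pT); exact: (posop_bmf IH).
split=> [u v bu bv|a u bu|u bu u0] /=.
- rewrite -(posfunD (posop_fun pT x)); [|exact: (posop_bmf IH)..].
  by congr T; apply/funext => y; rewrite (posfunD (posop_fun IH y)).
- rewrite -(posfunZ (posop_fun pT x)); last exact: (posop_bmf IH).
  by congr T; apply/funext => y; rewrite (posfunZ (posop_fun IH y)).
- apply: (posfun_ge0 (posop_fun pT x)); first exact: (posop_bmf IH).
  by move=> y; exact: (posfun_ge0 (posop_fun IH y)).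
Qed.

End bounded_measurable.

(** * The energy increment *)

Section energy_increment.
Context {R : realFieldType}.
Implicit Types p q r h s : R.

(** Expansion of [q ^+ 2 / r] about the slope [h]. The constraint [q <= r] forces [q = 0] when
    [r = 0], which takes care of division by zero. *)
Lemma sqr_div_expand q r h : 0 <= q -> q <= r ->
  q ^+ 2 / r = h ^+ 2 * r + 2 * h * (q - h * r) + (q - h * r) ^+ 2 / r.
Proof.
move=> q0 qr; have [r0|r0] := eqVneq r 0; last by field.
have -> : q = 0 by apply: le_anti; rewrite q0 -r0 qr.
by rewrite r0 invr0; ring.
Qed.

(** Quantified convexity. With [h = q / (p + q)] and [x = q1 - h * (p1 + q1)], the second half
    deviates by [- x], and the energy gain is exactly [x ^+ 2 / (p1 + q1) + x ^+ 2 / (p2 + q2)]. The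
    left side equals [|x| * (p + q) / max p q], hence is at most [2 * |x|], which the inequality of
    arithmetic and geometric means with weight [s] compares with the gain. *)
Lemma energy_split p q p1 p2 q1 q2 s : p = p1 + p2 -> q = q1 + q2 ->
  0 <= p1 -> 0 <= p2 -> 0 <= q1 -> 0 <= q2 -> 0 < s ->
  `|q / Num.max p q * p1 - p / Num.max p q * q1| <=
  s * (p + q) +
  (q1 ^+ 2 / (p1 + q1) + q2 ^+ 2 / (p2 + q2) - q ^+ 2 / (p + q)) / s.
Proof.
move=> pE qE p10 p20 q10 q20 s0.
have p0 : 0 <= p by rewrite pE addr_ge0.
have q0 : 0 <= q by rewrite qE addr_ge0.
have [r0|r0] := eqVneq (p + q) 0.
  have [z1 [z2 [z3 z4]]] : p1 = 0 /\ p2 = 0 /\ q1 = 0 /\ q2 = 0.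
    by do !split; lra.
  by rewrite pE qE z1 z2 z3 z4 !(addr0, mulr0, mul0r, expr0n, subrr, normr0).
have r1 : p1 + q1 + (p2 + q2) = p + q by rewrite pE qE; ring.
pose h := q / (p + q); pose x := q1 - h * (p1 + q1).
have x2 : q2 - h * (p2 + q2) = - x.
  rewrite /x (_ : q2 = q - q1); last by rewrite qE; ring.
  by rewrite (_ : p2 = p - p1) /h; [field|rewrite pE; ring].
rewrite (@sqr_div_expand q1 _ h) ?lerDr// (@sqr_div_expand q2 _ h) ?lerDr//.
rewrite -/x x2 sqrrN.
have -> : q ^+ 2 / (p + q) = h ^+ 2 * (p1 + q1) + h ^+ 2 * (p2 + q2).
  by rewrite -mulrDr r1 /h; field.
have xE : q * p1 - p * q1 = - (x * (p + q)) by rewrite /x /h; field.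
have {}r0 : 0 < p + q by rewrite lt_def r0 addr_ge0.
have pm : p <= Num.max p q by rewrite le_max lexx.
have qm : q <= Num.max p q by rewrite le_max lexx orbT.
move: (Num.max p q) pm qm => m pm qm.
have m0 : 0 < m by lra.
have -> : q / m * p1 - p / m * q1 = - (x * ((p + q) / m)).
  by transitivity ((q * p1 - p * q1) / m); [ring|rewrite xE; ring].
rewrite normrN normrM (@ger0_norm _ (_ / _)); last by rewrite divr_ge0// ltW.
have L : `|x| * ((p + q) / m) <= 2 * `|x|.
  by rewrite mulrC ler_wpM2r// ler_pdivrMr//; lra.
apply: (le_trans L).
have y0 : 0 <= x ^+ 2 / (p2 + q2) by rewrite divr_ge0 ?sqr_ge0// addr_ge0.
have -> : h ^+ 2 * (p1 + q1) + 2 * h * x + x ^+ 2 / (p1 + q1) +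
   (h ^+ 2 * (p2 + q2) + 2 * h * - x + x ^+ 2 / (p2 + q2)) -
   (h ^+ 2 * (p1 + q1) + h ^+ 2 * (p2 + q2)) =
   x ^+ 2 / (p1 + q1) + x ^+ 2 / (p2 + q2) by ring.
have M : 2 * `|x| <= s * (p1 + q1) + x ^+ 2 / (p1 + q1) / s.
  have [r10|r10] := eqVneq (p1 + q1) 0.
    rewrite r10 invr0 !mulr0 mul0r addr0 /x r10 mulr0 subr0.
    have -> : q1 = 0 by lra.
    by rewrite normr0 mulr0.
  rewrite -subr_ge0 -(real_normK (num_real x)).
  have -> : s * (p1 + q1) + `|x| ^+ 2 / (p1 + q1) / s - 2 * `|x| =
    (s * (p1 + q1) - `|x|) ^+ 2 / (s * (p1 + q1)).
    by field; rewrite r10 gt_eqF.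
  by rewrite divr_ge0 ?sqr_ge0// mulr_ge0 ?addr_ge0// ltW.
rewrite (le_trans M)// lerD//; last by rewrite ler_pM2r ?invr_gt0// lerDl.
by rewrite ler_pM2l//; lra.
Qed.

End energy_increment.

(** * Splitting a dominated operator into a finite rank part and a small remainder *)

Section regularity.
Context {d : measure_display} {E : measurableType d} {R : realType}.
Implicit Types (u v : E -> R) (phi lam : (E -> R) -> R)
  (T : (E -> R) -> E -> R) (I : finType).

Lemma posfunM phi g : posfun phi -> bmf g -> (forall x, 0 <= g x) ->
  posfun (fun u => phi (fun x => u x * g x)).
Proof.
move=> pphi bg g0; split=> [u v bu bv|a u bu|u bu u0].
- rewrite -posfunD//; [|exact: bmfM..]; congr phi; apply/funext => x.
  by rewrite mulrDl.
- rewrite -posfunZ//; [|exact: bmfM]; congr phi; apply/funext => x.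
  by rewrite mulrA.
- by apply: posfun_ge0 => // [|x]; [exact: bmfM|rewrite mulr_ge0].
Qed.

Lemma posfun_sumZ I (c : I -> R) (psi : I -> (E -> R) -> R) :
  (forall i, 0 <= c i) -> (forall i, posfun (psi i)) ->
  posfun (fun u => \sum_i c i * psi i u).
Proof.
move=> c0 ppsi; split=> [u v bu bv|a u bu|u bu u0].
- by rewrite -big_split/=; apply: eq_bigr => i _; rewrite (posfunD (ppsi i))// mulrDr.
- by rewrite mulr_sumr; apply: eq_bigr => i _; rewrite (posfunZ (ppsi i))// mulrCA.
- by apply: sumr_ge0 => i _; rewrite mulr_ge0// (posfun_ge0 (ppsi i)).
Qed.

Record pou I (g : I -> E -> R) : Prop := Pou {
  pou_bmf : forall i, bmf (g i);
  pou_ge0 : forall i x, 0 <= g i x;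
  pou_sum : forall x, \sum_i g i x = 1 }.

Lemma pou_posfun I (g : I -> E -> R) phi u : pou g -> posfun phi -> bmf u ->
  phi u = \sum_i phi (fun x => u x * g i x).
Proof.
move=> pg pphi bu.
rewrite -posfun_sum//; last by move=> i; apply: bmfM => //; exact: (pou_bmf pg).
by congr phi; apply/funext => x; rewrite -mulr_sumr (pou_sum pg) mulr1.
Qed.

Definition refine I (g : I -> E -> R) u (ib : I * bool) x :=
  g ib.1 x * (if ib.2 then u x else 1 - u x).

Lemma pou_refine I (g : I -> E -> R) u : pou g -> bmf u ->
  (forall x, 0 <= u x <= 1) -> pou (refine g u).
Proof.
move=> pg bu u01; split=> [[i b]|[i b] x|x].
- apply: bmfM; first exact: (pou_bmf pg).
  by case: b => //=; apply: bmfB => //; exact: bmf_cst.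
- rewrite mulr_ge0 ?(pou_ge0 pg)//; case: b => /=.
    by have /andP[] := u01 x.
  by rewrite subr_ge0; have /andP[] := u01 x.
- rewrite -(pair_bigA _ (fun i b => refine g u (i, b) x))/= -(pou_sum pg x).
  by apply: eq_bigr => i _; rewrite big_bool /refine/=; ring.
Qed.

Section energy.
Variables (T : (E -> R) -> E -> R) (phi : (E -> R) -> R) (theta : R).
Hypotheses (pT : posop T) (pphi : posfun phi).
Hypothesis dom : forall u, bmf u -> (forall x, 0 <= u x <= 1) ->
  forall x, T u x <= phi u + theta.

(** Models the squared L2 norm, with respect to [T^~ x + phi], of the density of [phi] averaged over
    the cells of [g]; refinement can only raise it. *)
Definition energy I (g : I -> E -> R) x :=
  \sum_i phi (g i) ^+ 2 / (T (g i) x + phi (g i)).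

Let T_ge0 u x : bmf u -> (forall y, 0 <= u y) -> 0 <= T u x.
Proof. by move=> bu u0; exact: (posfun_ge0 (posop_fun pT x)). Qed.

Let phi_ge0 u : bmf u -> (forall y, 0 <= u y) -> 0 <= phi u.
Proof. exact: posfun_ge0. Qed.

Lemma bmf_energy I (g : I -> E -> R) : pou g -> bmf (energy g).
Proof.
move=> [bg g0 _]; apply: bmf_sum => i; apply: (@bmf_div _ _ _ _ _ (phi (g i))).
- exact: bmf_cst.
- by apply: bmfD; [exact: (posop_bmf pT)|exact: bmf_cst].
- by move=> x; rewrite addr_ge0 ?T_ge0 ?phi_ge0.
- move=> x; rewrite ger0_norm ?sqr_ge0// expr2 ler_wpM2l ?phi_ge0//.
  by rewrite lerDr T_ge0.
Qed.

Lemma energy_le I (g : I -> E -> R) x : pou g -> energy g x <= phi (fun=> 1).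
Proof.
move=> pg; have [bg g0 _] := pg.
rewrite (pou_posfun pg pphi) ?bmf_cst//; last exact: bmf_cst.
apply: ler_sum => i _; have -> : (fun y => 1 * g i y) = g i.
  by apply/funext => y; rewrite mul1r.
have q0 := phi_ge0 (bg i) (g0 i); have p0 := T_ge0 x (bg i) (g0 i).
have [r0|r0] := eqVneq (T (g i) x + phi (g i)) 0.
  by rewrite r0 invr0 mulr0.
rewrite ler_pdivrMr ?lt_def ?r0 ?addr_ge0// expr2 ler_wpM2l//.
by rewrite lerDr.
Qed.

Section splitting.
Variables (I : finType) (g : I -> E -> R).
Hypothesis pg : pou g.

Let m i x := Num.max (T (g i) x) (phi (g i)).

Let p_ge0 i x : 0 <= T (g i) x.
Proof. by apply: T_ge0; [exact: (pou_bmf pg)|exact: (pou_ge0 pg)]. Qed.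

Let q_ge0 i : 0 <= phi (g i).
Proof. by apply: phi_ge0; [exact: (pou_bmf pg)|exact: (pou_ge0 pg)]. Qed.

Let m_ge0 i x : 0 <= m i x.
Proof. by rewrite le_max p_ge0. Qed.

Let bm i : bmf (m i).
Proof.
by apply: bmf_max; [exact: (posop_bmf pT) (pou_bmf pg i)|exact: bmf_cst].
Qed.

(** The density [T (g i) x / phi (g i)] capped at 1; the cap keeps [finite_part] below [phi]. *)
Definition fr_coef i x := T (g i) x / Num.max (T (g i) x) (phi (g i)).

(** The weight is the share of [T (g i) x] that exceeds [phi (g i)]. If [T] and [phi] were
    proportional on each cell, [finite_part] and [remainder] would add up to [T] exactly. *)
Definition remainder u x :=
  \sum_i (1 - phi (g i) / Num.max (T (g i) x) (phi (g i))) *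
     T (fun y => u y * g i y) x.

Definition finite_part u x :=
  \sum_i fr_coef i x * phi (fun y => u y * g i y).

Lemma bmf_fr_coef i : bmf (fr_coef i).
Proof.
apply: (@bmf_div _ _ _ _ _ 1) => //.
- exact: (posop_bmf pT) (pou_bmf pg i).
- exact: bm.
- exact: m_ge0.
- by move=> x; rewrite mul1r ger0_norm// le_max lexx.
Qed.

Lemma fr_coef_ge0 i x : 0 <= fr_coef i x.
Proof. by rewrite divr_ge0//; exact: m_ge0. Qed.

Lemma fr_coef_le1 i x : fr_coef i x <= 1.
Proof.
have [m0|m0] := eqVneq (m i x) 0.
  by rewrite /fr_coef -/(m i x) m0 invr0 mulr0.
by rewrite ler_pdivrMr ?lt_def ?m0 ?m_ge0// mul1r le_max lexx.
Qed.

Let w_le1 i x : phi (g i) / m i x <= 1.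
Proof.
have [m0|m0] := eqVneq (m i x) 0; first by rewrite m0 invr0 mulr0.
by rewrite ler_pdivrMr ?lt_def ?m0 ?m_ge0// mul1r le_max lexx orbT.
Qed.

Lemma posop_remainder : posop remainder.
Proof.
split=> [u bu|x].
  apply: bmf_sum => i; apply: bmfM; last first.
    by apply: (posop_bmf pT); exact: bmfM (pou_bmf pg i).
  apply: bmfB; first exact: bmf_cst.
  apply: (@bmf_div _ _ _ _ _ 1); [exact: bmf_cst|exact: bm|exact: m_ge0|].
  by move=> x; rewrite mul1r ger0_norm ?q_ge0// le_max lexx orbT.
apply: posfun_sumZ => [i|i]; first by rewrite subr_ge0 w_le1.
exact: (posfunM (posop_fun pT x) (pou_bmf pg i) (pou_ge0 pg i)).
Qed.

Lemma posop_finite_part : posop finite_part.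
Proof.
split=> [u bu|x].
  by apply: bmf_sum => i; apply: bmfM; [exact: bmf_fr_coef|exact: bmf_cst].
apply: posfun_sumZ => [i|i]; first exact: fr_coef_ge0.
exact: (posfunM pphi (pou_bmf pg i) (pou_ge0 pg i)).
Qed.

Lemma finite_part_le u x : bmf u -> (forall y, 0 <= u y) ->
  finite_part u x <= phi u.
Proof.
move=> bu u0; rewrite (pou_posfun pg pphi bu); apply: ler_sum => i _.
rewrite ler_piMl ?fr_coef_le1// phi_ge0//; first exact: bmfM (pou_bmf pg i).
by move=> y; rewrite mulr_ge0// (pou_ge0 pg).
Qed.

(* On the union of the cells where [T] exceeds [phi] the excess is at most
   [theta] by domination. *)
Lemma remainder1_le x : remainder (fun=> 1) x <= theta.
Proof.
pose c i : R := (phi (g i) < T (g i) x)%R%:R.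
have bc i : bmf (fun y => c i * g i y) by apply: bmfZ; exact: (pou_bmf pg).
pose U y := \sum_i c i * g i y.
have bU : bmf U by apply: bmf_sum.
have U01 y : 0 <= U y <= 1.
  rewrite sumr_ge0/=; last by move=> i _; rewrite mulr_ge0 ?ler0n ?(pou_ge0 pg).
  rewrite -(pou_sum pg y); apply: ler_sum => i _.
  by rewrite ler_piMl ?(pou_ge0 pg)// /c; case: ltP.
have := dom bU U01 x; rewrite -lerBlDl; apply: le_trans.
rewrite /U (posfun_sum pphi)// (posfun_sum (posop_fun pT x))//.
rewrite -sumrB; apply: ler_sum => i _.
rewrite (posfunZ pphi (c i) (pou_bmf pg i)).
rewrite (posfunZ (posop_fun pT x) (c i) (pou_bmf pg i)).
have -> : (fun y => 1 * g i y) = g i by apply/funext => y; rewrite mul1r.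
rewrite /c; case: ltP => pq.
  have p0 : 0 < T (g i) x by exact: le_lt_trans pq.
  by rewrite mulrBl !mul1r divfK ?gt_eqF.
rewrite !mul0r subrr; have [q0|q0] := eqVneq (phi (g i)) 0.
  have -> : T (g i) x = 0 by apply: le_anti; rewrite p_ge0 -q0 pq.
  by rewrite mulr0.
by rewrite divff// subrr mul0r.
Qed.

(** Cell by cell, the two weights combine into the cross term that [energy_split] bounds. *)
Lemma defectE u x : bmf u -> T u x - finite_part u x - remainder u x =
  \sum_i (phi (g i) / m i x * T (fun y => u y * g i y) x -
          T (g i) x / m i x * phi (fun y => u y * g i y)).
Proof.
move=> bu; rewrite (pou_posfun pg (posop_fun pT x) bu) -!sumrB.
by apply: eq_bigr => i _; rewrite /fr_coef /m; ring.
Qed.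

(** Sum of [energy_split] over the cells, each cut into its [u] and [1 - u] portions. *)
Lemma defect_le u s x : bmf u -> (forall y, 0 <= u y <= 1) -> 0 < s ->
  `|T u x - finite_part u x - remainder u x| <=
  s * (T (fun=> 1) x + phi (fun=> 1)) + (energy (refine g u) x - energy g x) / s.
Proof.
move=> bu u01 s0; rewrite defectE//.
rewrite (pou_posfun pg (posop_fun pT x) (bmf_cst 1)) (pou_posfun pg pphi (bmf_cst 1)).
rewrite /energy -(pair_bigA _ (fun i b => phi (refine g u (i, b)) ^+ 2 /
  (T (refine g u (i, b)) x + phi (refine g u (i, b)))))/=.
rewrite -sumrB -big_split/= mulr_sumr mulr_suml -big_split/=.
rewrite (le_trans (ler_norm_sum _ _ _))//; apply: ler_sum => i _.
rewrite big_bool/=.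
have pr := pou_refine pg bu u01.
have -> : (fun y => 1 * g i y) = g i by apply/funext => y; rewrite mul1r.
have -> : (fun y => u y * g i y) = refine g u (i, true).
  by apply/funext => y; rewrite /refine/= mulrC.
have gE : g i = (fun y => refine g u (i, true) y + refine g u (i, false) y).
  by apply/funext => y; rewrite /refine/=; ring.
have b1 := pou_bmf pr (i, true); have b2 := pou_bmf pr (i, false).
have pE : T (g i) x = T (refine g u (i, true)) x + T (refine g u (i, false)) x.
  by rewrite [in LHS]gE (posfunD (posop_fun pT x) b1 b2).
have qE : phi (g i) = phi (refine g u (i, true)) + phi (refine g u (i, false)).
  by rewrite [in LHS]gE (posfunD pphi b1 b2).
rewrite /m pE qE; apply: energy_split => //.
- exact: T_ge0 b1 (pou_ge0 pr _).
- exact: T_ge0 b2 (pou_ge0 pr _).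
- exact: phi_ge0 b1 (pou_ge0 pr _).
- exact: phi_ge0 b2 (pou_ge0 pr _).
Qed.

End splitting.

(** Mean energies of partitions are bounded, so some [g] is nearly maximal and no [u] can raise its
    mean energy much. As [g] is chosen before [u], the estimate is uniform in [u]. *)
Lemma regularity_unit lam (delta : R) : posfun lam -> 0 < delta ->
  exists (I : finType) (g : I -> E -> R), pou g /\
  forall u, bmf u -> (forall y, 0 <= u y <= 1) ->
  lam (fun x => `|T u x - finite_part g u x - remainder g u x|) <= delta.
Proof.
move=> plam delta0.
(* [N] bounds [T 1 x + phi 1] for all [x], by domination applied to the constant 1. *)
pose N := 2 * phi (fun=> 1) + `|theta|.
have phi1 : 0 <= phi (fun=> 1) by exact: posfun1_ge0.
have lam1 : 0 <= lam (fun=> 1) by exact: posfun1_ge0.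
have N0 : 0 <= N by rewrite addr_ge0// mulr_ge0.
(* Chosen so that [s * (N * lam 1) <= delta / 2]; the summand 1 keeps the denominator positive. *)
pose s : R := delta / (2 * (N * lam (fun=> 1) + 1)).
have D0 : 0 < 2 * (N * lam (fun=> 1) + 1).
  by rewrite mulr_gt0// ltr_wpDl// mulr_ge0.
have s0 : 0 < s by rewrite divr_gt0.
pose S := [set r | exists (I : finType) (g : I -> E -> R),
  pou g /\ r = lam (energy g)].
have S_le : ubound S (phi (fun=> 1) * lam (fun=> 1)).
  move=> _ [I [g [pg ->]]]; apply: posfun_le_cst => //; first exact: bmf_energy.
  by move=> x; exact: energy_le.
have Ssup : has_sup S.
  split; last by exists (phi (fun=> 1) * lam (fun=> 1)).
  exists (lam (energy (fun _ : unit => fun=> 1))), unit, (fun=> fun=> 1).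
  split=> //; split=> [i|i x|x]; [exact: bmf_cst|by []|].
  by rewrite big_const card_unit/= addr0.
(* The gap [s * delta / 2] to the supremum becomes [delta / 2] after the division by [s] in
   [defect_le]. *)
have [_ [I [g [pg ->]]] Sg] := sup_adherent (divr_gt0 (mulr_gt0 s0 delta0) (ltr0n _ 2)) Ssup.
exists I, g; split => // u bu u01.
have pr := pou_refine pg bu u01.
have be := bmf_energy pg; have be' := bmf_energy pr.
have bT1 : bmf (T (fun=> 1)) by apply: (posop_bmf pT); exact: bmf_cst.
have bN : bmf (fun x => T (fun=> 1) x + phi (fun=> 1)) by apply: bmfD => //; exact: bmf_cst.
have bD : bmf (fun x => energy (refine g u) x - energy g x) by exact: bmfB.
apply: (@le_trans _ _ (lam (fun x => s * (T (fun=> 1) x + phi (fun=> 1)) +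
    s^-1 * (energy (refine g u) x - energy g x)))).
  apply: posfun_le => //.
  - apply: bmf_norm; apply: bmfB; last exact: (posop_bmf (posop_remainder pg)).
    apply: bmfB; [exact: (posop_bmf pT)|exact: (posop_bmf (posop_finite_part pg))].
  - by apply: bmfD; exact: bmfZ.
  - by move=> x; rewrite [X in _ <= _ + X]mulrC; exact: defect_le.
rewrite posfunD//; [|exact: bmfZ..]; rewrite !posfunZ// posfunB//.
have L1 : lam (fun x => T (fun=> 1) x + phi (fun=> 1)) <= N * lam (fun=> 1).
  apply: posfun_le_cst => // x.
  have h01 (y : E) : 0 <= (1 : R) <= 1 by rewrite ler01 lexx.
  by have := dom (bmf_cst 1) h01 x; clear h01; have := ler_norm theta; rewrite /N; lra.
have L2 : lam (energy (refine g u)) - lam (energy g) <= s * delta / 2.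
  have : lam (energy (refine g u)) <= sup S.
    by apply: sup_upper_bound => //; exists (I * bool)%type, (refine g u).
  by move: Sg; lra.
have L3 : s^-1 * (lam (energy (refine g u)) - lam (energy g)) <= delta / 2.
  by rewrite mulrC ler_pdivrMr// mulrC mulrA.
have L4 : s * lam (fun x => T (fun=> 1) x + phi (fun=> 1)) <= delta / 2.
  apply: (le_trans (ler_wpM2l (ltW s0) L1)).
  rewrite /s -mulrA ler_pM2l// mulrC ler_pdivrMr// mulrA mulVf// mul1r.
  lra.
lra.
Qed.

(** The positive and negative parts of [u / M] take values in [[0, 1]], and each uses up half of
    [delta]. *)
Lemma regularity lam (delta : R) : posfun lam -> 0 < delta ->
  exists (I : finType) (g : I -> E -> R), pou g /\
  forall u M, bmf u -> 0 < M -> (forall y, `|u y| <= M) ->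
  lam (fun x => `|T u x - finite_part g u x - remainder g u x|) <= delta * M.
Proof.
move=> plam delta0.
have [I [g [pg H]]] := regularity_unit plam (divr_gt0 delta0 (ltr0n _ 2)).
exists I, g; split => // u M bu M0 uM.
pose u1 y := M^-1 * Num.max (u y) 0; pose u2 y := M^-1 * Num.max (- u y) 0.
have bNu : bmf (fun y => - u y).
  rewrite (_ : (fun y => - u y) = (fun y => -1 * u y)); first exact: bmfZ.
  by apply/funext => y; rewrite mulN1r.
have b1 : bmf u1 by apply: bmfZ; apply: bmf_max => //; exact: bmf_cst.
have b2 : bmf u2 by apply: bmfZ; apply: bmf_max => //; exact: bmf_cst.
have h1 y : 0 <= u1 y <= 1.
  apply/andP; split; first by rewrite mulr_ge0 ?invr_ge0 ?(ltW M0)// le_max lexx orbT.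
  rewrite /u1 mulrC ler_pdivrMr// mul1r.
  by rewrite ge_max (ltW M0) andbT (le_trans (ler_norm _)).
have h2 y : 0 <= u2 y <= 1.
  apply/andP; split; first by rewrite mulr_ge0 ?invr_ge0 ?(ltW M0)// le_max lexx orbT.
  rewrite /u2 mulrC ler_pdivrMr// mul1r.
  by rewrite ge_max (ltW M0) andbT (le_trans (ler_norm _))// normrN.
have uE : u = (fun y => M * u1 y - M * u2 y).
  apply/funext => y; rewrite /u1 /u2 !mulrA divff ?gt_eqF// !mul1r.
  by case: (ltP (u y) 0); case: (ltP (- u y) 0); lra.
pose D v x := T v x - finite_part g v x - remainder g v x.
have lin psi : posfun psi -> psi u = M * psi u1 - M * psi u2.
  move=> ppsi; rewrite [in LHS]uE (posfunB ppsi (bmfZ M b1) (bmfZ M b2)).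
  by rewrite (posfunZ ppsi _ b1) (posfunZ ppsi _ b2).
have bD v : bmf v -> bmf (fun x => `|D v x|).
  move=> bv; apply: bmf_norm; apply: bmfB; last exact: (posop_bmf (posop_remainder pg)).
  by apply: bmfB; [exact: (posop_bmf pT)|exact: (posop_bmf (posop_finite_part pg))].
have DE x : `|D u x| <= M * `|D u1 x| + M * `|D u2 x|.
  have -> : D u x = M * D u1 x - M * D u2 x.
    rewrite /D (lin _ (posop_fun pT x)).
    rewrite (lin _ (posop_fun (posop_finite_part pg) x)).
    by rewrite (lin _ (posop_fun (posop_remainder pg) x)); ring.
  by rewrite (le_trans (ler_normB _ _))// !normrM (gtr0_norm M0).
apply: (@le_trans _ _ (lam (fun x => M * `|D u1 x| + M * `|D u2 x|))).
  by apply: posfun_le => //; [exact: bD|apply: bmfD; apply: bmfZ; exact: bD].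
rewrite (posfunD plam (bmfZ M (bD _ b1)) (bmfZ M (bD _ b2))).
rewrite (posfunZ plam M (bD _ b1)) (posfunZ plam M (bD _ b2)).
have := ler_wpM2l (ltW M0) (H _ b1 h1); have := ler_wpM2l (ltW M0) (H _ b2 h2).
by rewrite -/(D u1) -/(D u2); lra.
Qed.

End energy.
End regularity.

(** * Finite rank approximation of the powers *)

Section finite_rank.
Context {d : measure_display} {E : measurableType d} {R : realType}.
Implicit Types (u v : E -> R) (phi lam : (E -> R) -> R)
  (T S : (E -> R) -> E -> R) (I : finType).

(** Signs are carried by the functions [s i], so the class is closed under negation while all
    functionals stay positive. *)
Definition finite_rank S := exists (I : finType) (a : I -> (E -> R) -> R)
  (s : I -> E -> R), [/\ forall i, posfun (a i), forall i, bmf (s i)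
    & forall u x, S u x = \sum_i a i u * s i x].

Lemma finite_rank0 : finite_rank (fun _ _ => 0).
Proof.
exists void, (fun _ _ => 0), (fun _ _ => 0).
by split=> [[]|[]|u x]; rewrite big1// => -[].
Qed.

Lemma finite_rankD S1 S2 : finite_rank S1 -> finite_rank S2 ->
  finite_rank (fun u x => S1 u x + S2 u x).
Proof.
move=> [I [a [s [pa bs SE]]]] [J [b [t [pb bt S'E]]]].
exists (I + J)%type, (fun k => match k with inl i => a i | inr j => b j end),
  (fun k => match k with inl i => s i | inr j => t j end).
by split=> [[]|[]|u x] //; rewrite big_sumType/= SE S'E.
Qed.

Lemma finite_rankN S : finite_rank S -> finite_rank (fun u x => - S u x).
Proof.
move=> [I [a [s [pa bs SE]]]]; exists I, a, (fun i x => -1 * s i x).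
split=> // [i|u x]; first exact: bmfZ.
by rewrite SE -sumrN; apply: eq_bigr => i _; rewrite mulN1r mulrN.
Qed.

Lemma finite_rank_comp S T : finite_rank S -> posop T ->
  finite_rank (fun u => S (T u)).
Proof.
move=> [I [a [s [pa bs SE]]]] pT; exists I, (fun i u => a i (T u)), s.
by split=> // i; exact: posfun_comp.
Qed.

Lemma finite_rankB S u v x : finite_rank S -> bmf u -> bmf v ->
  S (fun y => u y - v y) x = S u x - S v x.
Proof.
move=> [I [a [s [pa bs SE]]]] bu bv; rewrite !SE -sumrB.
by apply: eq_bigr => i _; rewrite posfunB// mulrBl.
Qed.

Lemma finite_rank_image T Q phi I (g : I -> E -> R) : posop T -> posop Q ->
  posfun phi -> pou g -> finite_rank (fun u => Q (finite_part T phi g u)).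
Proof.
move=> pT pQ pphi pg; exists I, (fun i u => phi (fun y => u y * g i y)),
  (fun i => Q (fr_coef T phi g i)).
have bc i := bmf_fr_coef phi pT pg i.
split=> [i|i|u x].
- exact: (posfunM pphi (pou_bmf pg i) (pou_ge0 pg i)).
- exact: (posop_bmf pQ).
transitivity (Q (fun y => \sum_i phi (fun y => u y * g i y) * fr_coef T phi g i y) x).
  by congr (Q _ x); apply/funext => y; apply: eq_bigr => i _; rewrite mulrC.
rewrite (posfun_sum (posop_fun pQ x)); last by move=> i; exact: bmfZ.
by apply: eq_bigr => i _; rewrite (posfunZ (posop_fun pQ x)).
Qed.

Lemma posop_norm T u x : posop T -> bmf u -> `|T u x| <= T (fun y => `|u y|) x.
Proof. by move=> pT bu; exact: (posfun_norm (posop_fun pT x)). Qed.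

Section power.
Variables (T : (E -> R) -> E -> R) (phi : (E -> R) -> R) (theta eta : R).
Hypotheses (pT : posop T) (pphi : posfun phi).
Hypothesis dom : forall u, bmf u -> (forall x, 0 <= u x <= 1) ->
  forall x, T u x <= phi u + theta.
Hypotheses (theta0 : 0 < theta) (eta0 : 0 < eta).

Lemma dominated_norm u M x : bmf u -> 0 < M -> (forall y, `|u y| <= M) ->
  `|T u x| <= phi (fun y => `|u y|) + theta * M.
Proof.
move=> bu M0 uM; apply: (le_trans (posop_norm x pT bu)).
have bn := bmf_norm bu.
have h01 y : 0 <= M^-1 * `|u y| <= 1.
  apply/andP; split; first by rewrite mulr_ge0// invr_ge0 ltW.
  by rewrite mulrC ler_pdivrMr// mul1r.
have := dom (bmfZ M^-1 bn) h01 x.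
rewrite (posfunZ pphi _ bn) (posfunZ (posop_fun pT x) _ bn).
rewrite -(ler_pM2l M0) mulrA divff ?gt_eqF// mul1r.
by rewrite mulrDr mulrA divff ?gt_eqF// mul1r [M * _]mulrC.
Qed.

(* The bound is [tau ^+ n * M + lam |u|] rather than a multiple of [M] because
   one step of the recursion costs [phi |u|] in sup norm, while in [lam]-mean it
   costs only the remainder, of norm at most [theta]. *)
Lemma power_decomposition n : exists S lam, [/\ finite_rank S, posfun lam,
  lam (fun=> 1) <= 2 * phi (fun=> 1) / eta * (theta + eta) ^+ n &
  forall u M, bmf u -> 0 < M -> (forall y, `|u y| <= M) -> forall x,
  `|iter n T u x - S u x| <= (theta + eta) ^+ n * M + lam (fun y => `|u y|)].
Proof.
have phi1 := posfun1_ge0 pphi.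
elim: n => [|n [S [lam [fS plam lam1 IH]]]].
  exists (fun _ _ => 0), (fun=> 0); split.
  - exact: finite_rank0.
  - by split=> *; rewrite ?addr0 ?mulr0.
  - by rewrite expr0 mulr1 divr_ge0 ?mulr_ge0// ltW.
  - by move=> u M _ _ uM x; rewrite subr0 expr0 mul1r addr0.
set tau := theta + eta in lam1 IH *.
have tau0 : 0 < tau by rewrite addr_gt0.
have taun : 0 < tau ^+ n by rewrite exprn_gt0.
(* The precision [eta * tau ^+ n], taken for the current [lam], is what raises [theta] to [tau] in
   the uniform term. *)
have [I [g [pg H]]] := regularity pT pphi dom plam (mulr_gt0 eta0 taun).
set F := finite_part T phi g in H; set Q := remainder T phi g in H.
have pF : posop F by exact: posop_finite_part.
have pQ : posop Q by exact: posop_remainder.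
have pTn := posop_iter n pT.
(* With this choice, [T^(n+1)] minus the new [S] is [(T^n - S)(T - F)]. The new functional is [lam]
   transported by [Q], plus the sup norm cost of [T - F]. *)
exists (fun u x => (S (T u) x + - S (F u) x) + iter n T (F u) x),
  (fun u => 2 * tau ^+ n * phi u + lam (Q u)); split.
- apply: finite_rankD; last exact: finite_rank_image.
  by apply: finite_rankD; [|apply: finite_rankN]; exact: finite_rank_comp.
- apply: posfun_axpy => //; last exact: posfun_comp.
  by rewrite mulr_ge0// ltW.
(* The constant [c = 2 * phi 1 / eta] solves the recursion: [2 * phi 1 = eta * c], and
   [eta * c + theta * c = tau * c]. *)
- have Q1 : lam (Q (fun=> 1)) <= theta * lam (fun=> 1).
    have bQ1 : bmf (Q (fun=> 1)) := posop_bmf pQ (bmf_cst 1).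
    apply: posfun_le_cst => //.
    by move=> x; exact: remainder1_le.
  have := ler_wpM2l (ltW theta0) lam1.
  have -> : 2 * tau ^+ n * phi (fun=> 1) =
      eta * (2 * phi (fun=> 1) / eta * tau ^+ n).
    by field; rewrite gt_eqF.
  rewrite exprS; move: Q1.
  move: (lam _) (lam _) (_ / eta) (tau ^+ n) => A B c t.
  by rewrite /tau; lra.
move=> u M bu M0 uM x.
have bn := bmf_norm bu.
have bT : bmf (T u) by exact: (posop_bmf pT).
have bF : bmf (F u) by exact: (posop_bmf pF).
have bQ : bmf (Q u) by exact: (posop_bmf pQ).
pose w y := T u y - F u y.
have bw : bmf w by exact: bmfB.
have -> : iter n.+1 T u x - (S (T u) x + - S (F u) x + iter n T (F u) x) =
    iter n T w x - S w x.
  rewrite iterSr /w (posfunB (posop_fun pTn x) bT bF) finite_rankB//.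
  by ring.
(* One [phi |u|] comes from [dominated_norm] for [T], the other from [finite_part_le] for [F]. *)
pose M' := theta * M + 2 * phi (fun y => `|u y|).
have phiu : 0 <= phi (fun y => `|u y|) by exact: posfun_ge0.
have M'0 : 0 < M' by rewrite ltr_pwDl ?mulr_gt0// mulr_ge0.
have wM' y : `|w y| <= M'.
  rewrite (le_trans (ler_normB _ _))//.
  have := dominated_norm y bu M0 uM.
  have := le_trans (posop_norm y pF bu) (finite_part_le pT pphi pg y bn (fun=> normr_ge0 _)).
  by rewrite /M'; lra.
apply: (le_trans (IH w M' bw M'0 wM' x)).
have : lam (fun y => `|w y|) <= eta * tau ^+ n * M + lam (Q (fun y => `|u y|)).
  apply: (le_trans _ (lerD (H u M bu M0 uM) (lexx _))).
  have bD : bmf (fun y => `|T u y - F u y - Q u y|) by apply: bmf_norm; exact: bmfB.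
  have bQn : bmf (Q (fun y => `|u y|)) by exact: (posop_bmf pQ).
  rewrite -posfunD//; apply: posfun_le => //; [exact: bmf_norm|exact: bmfD|].
  move=> y; rewrite -[w y](subrK (Q u y)) (le_trans (ler_normD _ _))//.
  by rewrite lerD2l posop_norm.
rewrite exprS /M'; move: (tau ^+ n) => t; move: (lam _) (lam _) (phi _) => A B D.
by rewrite /tau; lra.
Qed.

(** Since [lam 1] itself decays like [(theta + eta) ^+ n], the mean term is absorbed into the
    uniform one. *)
Lemma power_approx n : exists2 S, finite_rank S &
  forall u M, bmf u -> 0 < M -> (forall y, `|u y| <= M) -> forall x,
  `|iter n T u x - S u x| <=
    (1 + 2 * phi (fun=> 1) / eta) * (theta + eta) ^+ n * M.
Proof.
have [S [lam [fS plam lam1 H]]] := power_decomposition n.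
exists S => // u M bu M0 uM x; apply: (le_trans (H u M bu M0 uM x)).
have : lam (fun y => `|u y|) <= M * lam (fun=> 1).
  by apply: posfun_le_cst => //; exact: bmf_norm.
have := ler_wpM2l (ltW M0) lam1.
by move: (lam _) (lam _) (_ / eta) (_ ^+ n) => A B C D; lra.
Qed.

End power.
End finite_rank.

(** * Real coordinates in [Linfty V] *)

Import ComplexField ComplexField.Normc.
Local Open Scope complex_scope.

Section complex_modulus.
Context {R : realType}.
Implicit Types (z : R[i]) (a : R).

Lemma normc_real a : normc a%:C = `|a|.
Proof. by rewrite /normc /= expr0n addr0 sqrtr_sqr. Qed.

Lemma normci : normc ('i%C : R[i]) = 1.
Proof. by rewrite /normc /= expr0n add0r expr1n sqrtr1. Qed.

Lemma Re_le_normc z : `|complex.Re z| <= normc z.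
Proof. by rewrite -lecR; exact: normc_ge_Re. Qed.

Lemma Im_le_normc z : `|complex.Im z| <= normc z.
Proof.
by rewrite -[leRHS]mulr1 -normci -normcM -normrN -ReiNIm Re_le_normc.
Qed.

Lemma normc_le_ReIm z : normc z <= `|complex.Re z| + `|complex.Im z|.
Proof.
rewrite [in leLHS](complexE z) (le_trans (le_normcD _ _))//.
by rewrite normcM normci mul1r !normc_real.
Qed.

End complex_modulus.

Section coordinates.
Context {d : measure_display} {E : measurableType d} {R : realType}.
Variable V : E -> {posnum R}.
Hypothesis mV : measurable_fun [set: E] (fun x => (V x)%:num).
Implicit Types (u v : E -> R) (f g : Linfty V).

Definition reV f x := complex.Re (f x) / (V x)%:num.
Definition imV f x := complex.Im (f x) / (V x)%:num.

Let V_gt0 x : 0 < (V x)%:num. Proof. by []. Qed.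

Lemma reV_le f x : `|reV f x| <= Vnorm f.
Proof.
rewrite normrM normfV (gtr0_norm (V_gt0 x)) ler_pdivrMr//.
exact: le_trans (Re_le_normc _) (Vnorm_ub f x).
Qed.

Lemma imV_le f x : `|imV f x| <= Vnorm f.
Proof.
rewrite normrM normfV (gtr0_norm (V_gt0 x)) ler_pdivrMr//.
exact: le_trans (Im_le_normc _) (Vnorm_ub f x).
Qed.

Lemma Vnorm_le_ReIm f M : (forall x, `|reV f x| + `|imV f x| <= M) ->
  Vnorm f <= M.
Proof.
move=> fM; apply: Vnorm_le => x; rewrite (le_trans (normc_le_ReIm _))//.
rewrite -ler_pdivrMr// mulrDl; apply: le_trans (fM x).
by rewrite !normrM normfV (gtr0_norm (V_gt0 x)).
Qed.

Lemma bmf_reV f : bmf (reV f).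
Proof.
split; last by exists (Vnorm f) => x; exact: reV_le.
have := LinftyP f; rewrite inE => -[mf _ _].
by apply: measurable_funM => //; exact: measurable_inv.
Qed.

Lemma bmf_imV f : bmf (imV f).
Proof.
split; last by exists (Vnorm f) => x; exact: imV_le.
have := LinftyP f; rewrite inE => -[_ mf _].
by apply: measurable_funM => //; exact: measurable_inv.
Qed.

(* Junk value [0] when [u * V] is not in [Linfty V]. *)
Definition emb u : Linfty V := insubd 0 (fun x => (u x * (V x)%:num)%:C).

Lemma embE u x : bmf u -> emb u x = (u x * (V x)%:num)%:C.
Proof.
move=> [mu [M uM]]; rewrite /emb /insubd insubT//= inE; split.
- exact: measurable_funM.
- exact: measurable_cst.
- exists (M + 1).
    by rewrite ltr_wpDl// (le_trans _ (uM point)).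
  move=> y; rewrite normc_real normrM (gtr0_norm (V_gt0 y)) ler_wpM2r//.
  by rewrite (le_trans (uM y))// lerDl.
Qed.

Lemma Linfty_ext f g : (forall x, f x = g x) -> f = g.
Proof. by move=> fg; apply/val_inj/funext. Qed.

Lemma LinftyDE f g x : (f + g) x = f x + g x. Proof. by []. Qed.
Lemma LinftyBE f g x : (f - g) x = f x - g x. Proof. by []. Qed.
Lemma LinftyZE (c : R[i]) f x : (c *: f) x = c * f x. Proof. by []. Qed.

Lemma embD u v : bmf u -> bmf v -> emb (fun x => u x + v x) = emb u + emb v.
Proof.
move=> bu bv; apply: Linfty_ext => x.
by rewrite LinftyDE !embE//; [rewrite mulrDl rmorphD|exact: bmfD].
Qed.

Lemma embZ a u : bmf u -> emb (fun x => a * u x) = a%:C *: emb u.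
Proof.
move=> bu; apply: Linfty_ext => x.
by rewrite LinftyZE !embE//; [rewrite -mulrA rmorphM|exact: bmfZ].
Qed.

Lemma embB u v : bmf u -> bmf v -> emb (fun x => u x - v x) = emb u - emb v.
Proof.
move=> bu bv; apply: Linfty_ext => x.
by rewrite LinftyBE !embE//; [rewrite mulrBl rmorphB|exact: bmfB].
Qed.

Lemma reV_emb u x : bmf u -> reV (emb u) x = u x.
Proof. by move=> bu; rewrite /reV embE//= mulfK ?gt_eqF. Qed.

Lemma imV_emb u x : bmf u -> imV (emb u) x = 0.
Proof. by move=> bu; rewrite /imV embE//= mul0r. Qed.

Lemma emb_reim f : f = emb (reV f) + 'i%C *: emb (imV f).
Proof.
apply: Linfty_ext => x; rewrite LinftyDE LinftyZE !embE; [|exact: bmf_imV|exact: bmf_reV].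
by rewrite /reV /imV !divfK ?gt_eqF// -complexE.
Qed.

Lemma Vnorm_emb u M : bmf u -> (forall x, `|u x| <= M) -> Vnorm (emb u) <= M.
Proof.
move=> bu uM; apply: Vnorm_le_ReIm => x.
by rewrite reV_emb// imV_emb// normr0 addr0.
Qed.

Section real_part.
Variable T : {linear Linfty V -> Linfty V}.
Hypothesis T_ge0 : positive_op T.

Definition real_op u x := reV (T (emb u)) x.

Lemma emb_ge0 u x : bmf u -> (forall y, 0 <= u y) -> 0 <= emb u x.
Proof. by move=> bu u0; rewrite embE// ler0c mulr_ge0. Qed.

Lemma posop_real_op : posop real_op.
Proof.
split=> [u bu|x]; first exact: bmf_reV.
split=> [u v bu bv|a u bu|u bu u0]; rewrite /real_op.
- by rewrite embD// linearD /reV LinftyDE raddfD/= mulrDl.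
- by rewrite embZ// linearZ/= /reV LinftyZE; case: (T _ x) => b c /=; rewrite mul0r subr0 mulrA.
- have := T_ge0 (fun y => emb_ge0 y bu u0) x.
  by rewrite lecE => /andP[_ Tu]; rewrite divr_ge0.
Qed.

(** A positive operator preserves real functions: [0 <= z] in [R[i]] forces [z] real, and a bounded
    [u] is the difference of the nonnegative functions [u + M] and [M]. *)
Lemma real_opE u : bmf u -> T (emb u) = emb (real_op u).
Proof.
move=> bu; apply: Linfty_ext => x; rewrite embE; last exact: bmf_reV.
rewrite /real_op /reV divfK ?gt_eqF//.
have Im_emb0 v : bmf v -> (forall y, 0 <= v y) -> complex.Im (T (emb v) x) = 0.
  by move=> bv v0; apply: ger0_Im; apply: T_ge0 => y; exact: emb_ge0.
suff : complex.Im (T (emb u) x) = 0 by case: (T _ x) => a b /= ->.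
have [_ [M uM]] := bu; have bM := bmf_cst M : bmf (fun _ : E => M).
have M0 : 0 <= M := le_trans (normr_ge0 _) (uM point).
have -> : u = (fun y => (u y + M) - M) by apply/funext => y; rewrite addrK.
have bD := bmfD bu bM.
rewrite embB// linearB LinftyBE raddfB/= !Im_emb0 ?subrr// => y.
by rewrite -lerBlDr sub0r; have := uM y; rewrite ler_norml => /andP[].
Qed.

Lemma iter_real_op n u : bmf u -> iter n T (emb u) = emb (iter n real_op u).
Proof.
move=> bu; elim: n => //= n ->; rewrite real_opE//.
exact: (posop_bmf (posop_iter n posop_real_op)).
Qed.

Lemma iter_reim n f : iter n T f =
  emb (iter n real_op (reV f)) + 'i%C *: emb (iter n real_op (imV f)).
Proof.
rewrite -!iter_real_op; [|exact: bmf_imV|exact: bmf_reV].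
rewrite [in LHS](emb_reim f); elim: n => //= n ->.
by rewrite linearD linearZ.
Qed.

End real_part.

Section complexification.
Variables (I : finType) (a : I -> (E -> R) -> R) (s : I -> E -> R).
Hypothesis pa : forall i, posfun (a i).

(** Complex linear extension of the real operator [u |-> \sum_i a i u * s i]. The factor [i] is
    attached to the vectors, so all coefficients are real and compactness only needs real
    segments. *)
Definition cplx f : Linfty V :=
  \sum_i ((a i (reV f))%:C *: emb (s i)) +
  \sum_i ((a i (imV f))%:C *: ('i%C *: emb (s i))).

Lemma cplx_linear : linear cplx.
Proof.
move=> c f g; rewrite /cplx scalerDr !scaler_sumr -!big_split/=.
have bre := bmf_reV f; have bim := bmf_imV f.
apply: eq_bigr => i _.
have -> : a i (reV (c *: f + g)) =
    complex.Re c * a i (reV f) - complex.Im c * a i (imV f) + a i (reV g).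
  rewrite -!(posfunZ (pa i))// -posfunB//; [|exact: bmfZ..].
  rewrite -posfunD//; [|by apply: bmfB; exact: bmfZ|exact: bmf_reV].
  congr a; apply/funext => x; rewrite /reV /imV LinftyDE LinftyZE.
  by case: c (f x) (g x) => ? ? [? ?] [? ?] /=; ring.
have -> : a i (imV (c *: f + g)) =
    complex.Re c * a i (imV f) + complex.Im c * a i (reV f) + a i (imV g).
  rewrite -!(posfunZ (pa i))// -posfunD//; [|exact: bmfZ..].
  rewrite -posfunD//; [|by apply: bmfD; exact: bmfZ|exact: bmf_imV].
  congr a; apply/funext => x; rewrite /reV /imV LinftyDE LinftyZE.
  by case: c (f x) (g x) => ? ? [? ?] [? ?] /=; ring.
rewrite !scalerA -!scalerDl; congr (_ *: _).
by case: c => c1 c2; apply/eqP; rewrite eq_complex/=; apply/andP; split; apply/eqP; ring.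
Qed.

End complexification.
End coordinates.

(** * Compactness in [Linfty V] *)

Section compactness.
Context {d : measure_display} {E : measurableType d} {R : realType}.
Variable V : E -> {posnum R}.
Hypothesis mV : measurable_fun [set: E] (fun x => (V x)%:num).
Implicit Types (u v : E -> R) (f g : Linfty V).

Lemma continuous_real_scale f : continuous (fun a : R => a%:C *: f : Linfty V).
Proof.
move=> a; apply/cvgrPdist_lt => e e0.
have eE : e = (complex.Re e)%:C.
  by rewrite RRe_real// gtr0_real.
have {}e0 : 0 < complex.Re e by move: e0; rewrite ltcE => /andP[].
have N0 : 0 < Vnorm f + 1 by rewrite ltr_wpDl// Vnorm_ge0.
near=> b.
rewrite -scalerBl -rmorphB normrZ eE Linfty_normE.
rewrite -[`|_%:C|]/((normc _)%:C) normc_real -rmorphM ltcR.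
apply: (@le_lt_trans _ _ (`|a - b| * (Vnorm f + 1))).
  by rewrite ler_wpM2l// lerDl.
rewrite -ltr_pdivlMr//; near: b.
by apply: cvgr_dist_lt => //; rewrite divr_gt0.
Unshelve. all: by end_near. Qed.

(** Induction on [r]: the new term ranges over a compact segment, and the sum of two compact sets is
    compact. *)
Lemma bounded_combination_compact (I : Type) (s : I -> Linfty V) (M : R)
  (r : seq I) : exists2 A : set (Linfty V), compact A &
  forall c : I -> R, (forall i, `|c i| <= M) -> A (\sum_(i <- r) (c i)%:C *: s i).
Proof.
elim: r => [|i r [A cA HA]].
  by exists [set 0]; [exact: compact_set1|move=> c _; rewrite big_nil].
pose B := (fun a : R => a%:C *: s i : Linfty V) @` `[- M, M]%classic.
have cB : compact B.
  apply: continuous_compact; last exact: segment_compact.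
  exact/continuous_subspaceT/continuous_real_scale.
exists ((fun p : Linfty V * Linfty V => p.1 + p.2) @` (B `*` A)).
  apply: continuous_compact; last exact: compact_setX.
  exact/continuous_subspaceT/add_continuous.
move=> c cM; rewrite big_cons.
exists ((c i)%:C *: s i, \sum_(j <- r) (c j)%:C *: s j) => //=.
split=> /=; last exact: HA.
by exists (c i) => //=; rewrite in_itv/= -ler_norml.
Qed.

Lemma bounded_setP (A : set (Linfty V)) : bounded_set A ->
  exists2 M, 0 < M & forall f, A f -> Vnorm f <= M.
Proof.
move=> /pinfty_ex_gt0[M M0 AM]; exists (complex.Re M).
  by move: M0; rewrite ltcE => /andP[].
by move=> f /AM/=; rewrite Linfty_normE lecE => /andP[].
Qed.

Lemma compact_op_cplx (I : finType) (a : I -> (E -> R) -> R) (s : I -> E -> R)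
  (L : {linear Linfty V -> Linfty V}) : (forall i, posfun (a i)) ->
  (forall f, L f = cplx a s f) -> compact_op L.
Proof.
move=> pa LE A /bounded_setP[M M0 AM].
(* Positive functionals are bounded by their value at 1; summing over [i] gives one bound for all of
   them. *)
pose C := \sum_i M * a i (fun=> 1).
have aC u : bmf u -> (forall x, `|u x| <= M) -> forall i, `|a i u| <= C.
  move=> bu uM i; apply: (le_trans (posfun_bound (pa i) bu uM)).
  rewrite /C (bigD1 i)//= lerDl sumr_ge0// => j _.
  by rewrite mulr_ge0 ?(ltW M0)// posfun1_ge0.
have [A1 cA1 H1] := bounded_combination_compact (fun i => emb V (s i)) C (index_enum I).
have [A2 cA2 H2] := bounded_combination_compact (fun i => 'i%C *: emb V (s i)) C (index_enum I).
apply: (@precompact_subset _ _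
    ((fun p : Linfty V * Linfty V => p.1 + p.2) @` (A1 `*` A2))); last first.
  apply: compact_precompact; first exact: norm_hausdorff.
  apply: continuous_compact; last exact: compact_setX.
  exact/continuous_subspaceT/add_continuous.
move=> _ [f Af <-]; rewrite LE.
exists (\sum_i (a i (reV f))%:C *: emb V (s i),
        \sum_i (a i (imV f))%:C *: ('i%C *: emb V (s i))) => //.
split=> /=.
- apply: H1; apply: aC; first exact: bmf_reV.
  by move=> x; exact: le_trans (reV_le f x) (AM _ Af).
- apply: H2; apply: aC; first exact: bmf_imV.
  by move=> x; exact: le_trans (imV_le f x) (AM _ Af).
Qed.

Lemma opnorm_le (F : Linfty V -> Linfty V) C :
  (forall f, Vnorm f <= 1 -> Vnorm (F f) <= C) -> opnorm F <= C.
Proof.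
move=> FC; apply: ge_sup.
  by exists (complex.Re `|F 0|), 0 => //=; rewrite normr0.
by move=> _ [f /= f1 <-]; apply: FC; move: f1; rewrite -lecR.
Qed.

Lemma opnorm_ge0 (F : Linfty V -> Linfty V) : 0 <= opnorm F.
Proof.
rewrite /opnorm; set S := [set _ | _ in _].
(* Without a supremum, [sup] takes the default value 0. *)
have [hS|/sup_out ->//] := pselect (has_sup S).
apply: (@le_trans _ _ (complex.Re `|F 0|)); first exact: Vnorm_ge0.
by apply: sup_upper_bound => //; exists 0 => //=; rewrite normr0.
Qed.

Section compact_net.
Variable K : {linear Linfty V -> Linfty V}.
Hypothesis cK : compact_op K.

(** Balls centred at [K f], with [f] among the test functions, cover the compact closure of the
    image; the centres of a finite subcover provide the net. *)
Lemma real_op_net (e : R) : 0 < e -> exists (I : finType) (h : I -> E -> R),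
  (forall i, bmf (h i) /\ forall x, 0 <= h i x <= 1) /\
  forall u, bmf u -> (forall x, 0 <= u x <= 1) ->
  exists i, forall x, `|real_op K u x - real_op K (h i) x| <= e.
Proof.
move=> e0.
pose A := [set emb V u | u in [set u | bmf u /\ forall x, 0 <= u x <= 1]].
have bA : bounded_set A.
  exists 1; split=> // M M1 _ [u [bu u01] <-]; apply: le_trans (ltW M1).
  rewrite Linfty_normE -[1]/(1%:C) lecR; apply: Vnorm_emb => // x.
  by have /andP[u0 u1] := u01 x; rewrite ger0_norm.
have := cK bA; rewrite precompactE compact_cover => /(_ (Linfty V) A).
have e0' : 0 < e%:C by rewrite -[0]/(0%:C) ltcR.
move=> /(_ (fun f => ball (K f) e%:C)).
case.
- by move=> f _; exact: ball_open.
- move=> g /(_ _ (nbhsx_ballx g _ e0'))[_ [[f Af <-] gf]].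
  by exists f => //; exact: ball_sym.
move=> D DA AD.
pose h (i : seq_sub (finmap.enum_fset D)) := reV (ssval i).
exists (seq_sub (finmap.enum_fset D)), h; split=> [i|u bu u01].
  have := DA _ (ssvalP i); rewrite inE => -[u [bu u01] uE].
  by split=> [|x]; rewrite /h -uE; [exact: bmf_reV|rewrite reV_emb].
have : (closure (K @` A)) (K (emb V u)).
  by apply: subset_closure; exists (emb V u) => //; exists u.
move=> /AD[f fD fu]; exists (SeqSub fD) => x.
have -> : real_op K (h (SeqSub fD)) x = reV (K f) x.
  have := DA _ fD; rewrite inE => -[v [bv v01] vE].
  rewrite /real_op /h/= -vE; congr (reV (K _) _); congr emb.
  by apply/funext => y; rewrite reV_emb.
have <- : reV (K (emb V u) - K f) x = real_op K u x - reV (K f) x.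
  by rewrite /real_op /reV LinftyBE raddfB/= mulrBl.
apply: le_trans (reV_le _ _) _.
move: fu; rewrite -ball_normE/= distrC Linfty_normE ltcR; exact: ltW.
Qed.

End compact_net.
End compactness.

(** * The essential spectral radius *)

(** A cell records the integer parts of all [h i x / e]; the bound [B] leaves finitely many
    possibilities. *)
Lemma finite_cells (E : Type) (R : realType) (I : finType) (h : I -> E -> R)
  (B e : R) : 0 < e -> (forall i x, 0 <= h i x <= B) ->
  exists (J : finType) (cell : E -> J),
  forall x y, cell x = cell y -> forall i, `|h i x - h i y| <= e.
Proof.
move=> e0 hB; pose t i x := Num.truncn (h i x / e).
have tB i x : (t i x < (Num.truncn (B / e)).+1)%N.
  rewrite ltnS le_truncn// ler_pM2r ?invr_gt0//.
  by have /andP[] := hB i x.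
exists {ffun I -> 'I_(Num.truncn (B / e)).+1}, (fun x => [ffun i => Ordinal (tB i x)]).
move=> x y /ffunP xy i; have := xy i; rewrite !ffunE => -[].
rewrite /t; have h0 z : 0 <= h i z / e.
  by rewrite divr_ge0 ?(ltW e0)//; have /andP[] := hB i z.
have := truncn_itv (h0 x); have := truncn_itv (h0 y).
move=> + + txy; rewrite txy -natr1; move: (_%:R) => k ky kx.
have -> : h i x - h i y = (h i x / e - h i y / e) * e.
  by rewrite -mulrBl divfK// gt_eqF.
rewrite normrM (gtr0_norm e0) ler_piMl ?(ltW e0)// ler_norml.
by apply/andP; split; lra.
Qed.

Section quasi_compactness.
Context {d : measure_display} {E : measurableType d} {R : realType}.
Variable V : E -> {posnum R}.
Hypothesis mV : measurable_fun [set: E] (fun x => (V x)%:num).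
Implicit Types (u v p q : E -> R) (f g : Linfty V).

(** Some net function [h i] has image within [e / 3] of that of [u], and the image of [h i] varies
    by at most [e / 3] on a cell. Hence [K u] at [x] exceeds its value at the representative of the
    cell of [x] by at most [e]; [phi] sums the values at all representatives. *)
Lemma compact_domination (K : {linear Linfty V -> Linfty V}) (e : R) :
  positive_op K -> compact_op K -> 0 < e ->
  exists2 phi, posfun phi & forall u, bmf u -> (forall x, 0 <= u x <= 1) ->
  forall x, real_op K u x <= phi u + e.
Proof.
move=> K_ge0 cK e0; have pK := posop_real_op mV K_ge0.
have e3 : 0 < e / 3 by rewrite divr_gt0.
have [I [h [hP net]]] := real_op_net mV cK e3.
have KB u x : bmf u -> (forall y, 0 <= u y <= 1) ->
    0 <= real_op K u x <= Vnorm (K (emb V (fun=> 1))).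
  move=> bu u01; apply/andP; split.
    by apply: (posfun_ge0 (posop_fun pK x)) => // y; have /andP[] := u01 y.
  apply: le_trans (le_trans (ler_norm _) (reV_le (K (emb V (fun=> 1))) x)).
  apply: (posfun_le (posop_fun pK x)) => //; first exact: bmf_cst.
  by move=> y; have /andP[] := u01 y.
have [J [cell cellP]] := finite_cells e3
  (fun i x => KB (h i) x (proj1 (hP i)) (proj2 (hP i))).
(* An empty cell gets the default [point], which only adds a nonnegative term to [phi]. *)
pose rep j := xget point [set x | cell x = j].
have repP x : cell (rep (cell x)) = cell x.
  exact: (xgetPex point (ex_intro (fun y => cell y = cell x) x erefl)).
exists (fun u => \sum_j 1 * real_op K u (rep j)).
  by apply: (posfun_sumZ (fun=> ler01)) => j; exact: (posop_fun pK).
move=> u bu u01 x.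
rewrite (bigD1 (cell x))//= mul1r.
have S0 : 0 <= \sum_(j | j != cell x) 1 * real_op K u (rep j).
  by apply: sumr_ge0 => j _; rewrite mul1r; have /andP[] := KB u (rep j) bu u01.
have [i ui] := net u bu u01.
have := cellP _ _ (repP x) i; have := ui x; have := ui (rep (cell x)).
rewrite !ler_norml => /andP[a1 a2] /andP[a3 a4] /andP[a5 a6].
by clear -S0 a1 a2 a3 a4 a5 a6; lra.
Qed.

Lemma Linfty_sumE (I : Type) (r : seq I) (F : I -> Linfty V) x :
  (\sum_(i <- r) F i) x = \sum_(i <- r) F i x.
Proof. by elim/big_rec2 : _ => // i c g _ <-. Qed.

Lemma cplxE (I : finType) (a : I -> (E -> R) -> R) (s : I -> E -> R) f :
  (forall i, bmf (s i)) ->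
  cplx a s f = emb V (fun x => \sum_i a i (reV f) * s i x) +
               'i%C *: emb V (fun x => \sum_i a i (imV f) * s i x).
Proof.
move=> bs.
have H (c : I -> R) : emb V (fun x => \sum_i c i * s i x) =
    \sum_i (c i)%:C *: emb V (s i).
  apply: Linfty_ext => x; rewrite Linfty_sumE embE//; last first.
    by apply: bmf_sum => i; exact: bmfZ.
  rewrite mulr_suml rmorph_sum; apply: eq_bigr => i _.
  by rewrite LinftyZE embE// -mulrA rmorphM.
rewrite !H scaler_sumr; congr (_ + _); apply: eq_bigr => i _.
by rewrite !scalerA mulrC.
Qed.

Lemma Vnorm_reim_le p q M : bmf p -> bmf q ->
  (forall x, `|p x| <= M) -> (forall x, `|q x| <= M) ->
  Vnorm (emb V p + 'i%C *: emb V q) <= 2 * M.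
Proof.
move=> bp bq pM qM; apply: Vnorm_le_ReIm => x.
rewrite /reV /imV LinftyDE LinftyZE !embE//=.
rewrite !(mul0r, mul1r, subr0, add0r, mulr0, addr0, subrr) !mulfK ?gt_eqF//.
by have := pM x; have := qM x; lra.
Qed.

Section positive_operator.
Variables (T K : {linear Linfty V -> Linfty V}) (theta : R).
Hypotheses (T_ge0 : positive_op T) (K_ge0 : positive_op K) (cK : compact_op K).
Hypothesis theta0 : 0 < theta.
Hypothesis TK : forall u, bmf u -> (forall x, 0 <= u x <= 1) ->
  forall x, real_op T u x <= real_op K u x + theta.

Lemma power_compact_approx (tau : R) : theta < tau -> exists C : R, forall n,
  exists2 L : {linear Linfty V -> Linfty V}, compact_op L &
  opnorm (fun f => iter n T f - L f) <= C * tau ^+ n.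
Proof.
(* Half of the gap [tau - theta] pays for replacing [K] by [phi], the other half is the [eta] of
   [power_approx]. *)
move=> theta_tau; have eta0 : 0 < (tau - theta) / 2 by lra.
have [phi pphi dom] := compact_domination K_ge0 cK eta0.
have pT := posop_real_op mV T_ge0.
have domT u : bmf u -> (forall x, 0 <= u x <= 1) ->
    forall x, real_op T u x <= phi u + (theta + (tau - theta) / 2).
  by move=> bu u01 x; have := TK bu u01 x; have := dom u bu u01 x; lra.
have theta'0 : 0 < theta + (tau - theta) / 2 by exact: addr_gt0.
pose C := 1 + 2 * phi (fun=> 1) / ((tau - theta) / 2).
exists (2 * C) => n.
have [S [I [a [s [pa bs SE]]]] HS] := power_approx pT pphi domT theta'0 eta0 n.
have tauE : theta + (tau - theta) / 2 + (tau - theta) / 2 = tau by lra.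
rewrite tauE -/C in HS.
pose L : {linear Linfty V -> Linfty V} := HB.pack (cplx a s)
  (GRing.isLinear.Build _ _ _ _ (cplx a s) (cplx_linear mV s pa)).
exists L; first exact: (compact_op_cplx mV pa (L := L)).
apply: opnorm_le => f f1.
rewrite (iter_reim mV T_ge0) -[L f]/(cplx a s f) cplxE//.
have bT u : bmf u -> bmf (iter n (real_op T) u) by exact: (posop_bmf (posop_iter n pT)).
have bre := bmf_reV mV f; have bim := bmf_imV mV f.
have bS (c : I -> R) : bmf (fun x => \sum_i c i * s i x).
  by apply: bmf_sum => i; exact: bmfZ.
rewrite opprD addrACA -scalerBr -!embB//; [|exact: bT..].
have HS1 u : bmf u -> (forall x, `|u x| <= Vnorm f) -> forall x,
    `|iter n (real_op T) u x - \sum_i a i u * s i x| <= C * tau ^+ n.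
  (* The bound 1 is used instead of [Vnorm f], which may vanish while [HS] needs a positive
     bound. *)
  move=> bu uf x; have := HS u 1 bu ltr01 (fun y => le_trans (uf y) f1) x.
  by rewrite SE mulr1.
rewrite -mulrA; apply: Vnorm_reim_le.
- by apply: bmfB; [exact: bT|exact: bS].
- by apply: bmfB; [exact: bT|exact: bS].
- by apply: HS1 => //; exact: reV_le.
- by apply: HS1 => //; exact: imV_le.
Qed.

(* [limn] of a divergent sequence is the default point [0], so the eventual
   upper bound suffices whether or not the defining limit exists. *)
Lemma ess_spectral_radius_le : ess_spectral_radius T <= theta.
Proof.
apply/ler_addgt0Pr => e e0; rewrite /ess_spectral_radius.
set w := (X in limn X).
(* The powers of the intermediate [t] leave room for [C]: eventually [C * t ^+ n <= t' ^+ n]. *)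
pose t := theta + e / 2; pose t' := theta + e.
have theta_t : theta < t by rewrite ltrDl divr_gt0.
have t_t' : t < t' by rewrite ltrD2l ltr_pdivrMr// ltr_pMr// ltr1n.
have t0 : 0 < t by exact: lt_trans theta0 theta_t.
have t'0 : 0 < t' by exact: lt_trans t0 t_t'.
have [C HC] := power_compact_approx theta_t.
have [cw|dw] := pselect (cvgn w); last first.
  by rewrite (dvgP dw) -[point]/(0 : R) ltW.
have q1 : `|t / t'| < 1.
  by rewrite ger0_norm ?divr_ge0 ?ltW// ltr_pdivrMr// mul1r.
have C0 : 0 < `|C| + 1 by rewrite ltr_wpDl.
apply: limr_le => //; near=> n.
(* At [n = 0] the exponent [n%:R^-1] is 0 and the root does not undo the power. *)
have n0 : (0 < n)%N by near: n; exact: nbhs_infty_gt.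
have [L cL HL] := HC n.
have Ct : C * t ^+ n <= t' ^+ n.
  have qn : (t / t') ^+ n <= (`|C| + 1)^-1.
    near: n; move/cvgrPdist_le : (cvg_expr q1) => /(_ (`|C| + 1)^-1).
    rewrite invr_gt0 => /(_ C0); apply: filterS => n.
    by rewrite sub0r normrN; exact: le_trans (ler_norm _).
  have tn : (`|C| + 1) * t ^+ n <= t' ^+ n.
    by rewrite -ler_pdivlMl// -ler_pdivrMr ?exprn_gt0// -expr_div_n.
  apply: le_trans tn; rewrite ler_wpM2r ?exprn_ge0 ?(ltW t0)//.
  by rewrite (le_trans (ler_norm C))// lerDl.
apply: (@le_trans _ _ (opnorm (fun f => iter n T f - L f) `^ n%:R^-1)).
  apply: ge_inf; last by exists L.
  by exists 0 => _ [L' _ <-]; exact: powR_ge0.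
apply: (@le_trans _ _ ((t' ^+ n) `^ n%:R^-1)).
  apply: ge0_ler_powR; rewrite ?nnegrE ?invr_ge0 ?ler0n ?opnorm_ge0 ?exprn_ge0 ?(ltW t'0)//.
  exact: le_trans HL Ct.
rewrite -powR_mulrn ?(ltW t'0)// -powRrM mulfV ?powRr1 ?(ltW t'0)//.
by rewrite pnatr_eq0 -lt0n.
Unshelve. all: by end_near. Qed.

End positive_operator.
End quasi_compactness.

(** * Kernel operators and the theorem *)

Lemma kernel_op_ge0 {R : realType} {d : measure_display} {E : measurableType d}
    {V : E -> {posnum R}} (P : R.-sigmafker E ~> E)
    (T : {linear Linfty V -> Linfty V}) : kernel_op P T -> positive_op T.
Proof.
move=> PT f f0 x; have [_ _ ->] := PT f x.
have Im0 : (fun y => complex.Im (f y)) = cst 0.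
  by apply/funext => y; exact: ger0_Im.
rewrite lecE/= Im0; apply/andP; split; first by rewrite /Rintegral integral0.
apply: Rintegral_ge0 => y _.
by have := f0 y; rewrite lecE => /andP[].
Qed.

(* P is the kernel and T the operator f |-> Pf it defines on Linfty V. *)
Theorem proposition5 (R : realType) (d : measure_display)
    (E : measurableType d) (hE : countably_generated E)
    (V : E -> {posnum R}) (mV : measurable_fun [set: E] (fun x => (V x)%:num))
    (P : R.-sigmafker E ~> E)
    (T : {linear Linfty V -> Linfty V}) (PT : kernel_op P T)
    (bT : bounded_op T)
    (EK : set E) (mEK : measurable EK)
    (theta1 : R) (h1_gt0 : 0 < theta1) (h1_lt : theta1 < spectral_radius T)
    (h1 : forall x, ~ EK x ->
      (\int[P x]_y ((V y)%:num)%:E <= (theta1 * (V x)%:num)%:E)%E)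
    (theta2 : R) (h2_gt0 : 0 < theta2) (h2_lt : theta2 < spectral_radius T)
    (K : {linear Linfty V -> Linfty V}) (posK : positive_op K)
    (cK : compact_op K)
    (h2 : forall x, EK x -> forall f : Linfty V, (forall y, 0 <= f y) ->
      0 <= T f x /\ T f x <= K f x + (theta2 * (V x)%:num)%:C * `|f|) :
  quasi_compact T /\ ess_spectral_radius T <= Num.max theta1 theta2.
Proof.
have T_ge0 := kernel_op_ge0 PT.
suff ess_le : ess_spectral_radius T <= Num.max theta1 theta2.
  (* Both constants lie below the spectral radius, so the bound already gives quasi-compactness. *)
  by split=> //; apply: (le_lt_trans ess_le); rewrite gt_max h1_lt.
have max_gt0 : 0 < Num.max theta1 theta2 by rewrite lt_max h1_gt0.
apply: (ess_spectral_radius_le mV T_ge0 posK cK max_gt0) => u bu u01 x.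
have u0 y : 0 <= u y by have /andP[] := u01 y.
have pT := posop_fun (posop_real_op mV T_ge0) x.
(* On [EK] the domination hypothesis applies to [emb V u], of norm at most 1. Outside, [T u <= T 1],
   and [T 1] in real coordinates is [PV / V], at most [theta1]. *)
have [EKx|nEKx] := pselect (EK x).
  have [_] := h2 x EKx (emb V u) (fun y => emb_ge0 mV y bu u0).
  rewrite lecE => /andP[_].
  rewrite Linfty_normE -rmorphM raddfD/= => Tu.
  rewrite /real_op /reV ler_pdivrMr// mulrDl divfK ?gt_eqF//.
  apply: (le_trans Tu); rewrite lerD2l mulrAC ler_wpM2r//.
  have uN : Vnorm (emb V u) <= 1.
    by apply: Vnorm_emb => // y; rewrite ger0_norm//; have /andP[] := u01 y.
  by rewrite (le_trans (ler_piMr (ltW h2_gt0) uN))// le_max lexx orbT.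
have b1 : bmf (fun _ : E => 1 : R) := bmf_cst 1.
have T1 : real_op T (fun=> 1) x <= theta1.
  rewrite /real_op /reV ler_pdivrMr//.
  have [intV _ ->] := PT (emb V (fun=> 1)) x; rewrite /kernel_int/=.
  have embV : (fun y => complex.Re (emb V (fun=> 1) y)) = (fun y => (V y)%:num).
    by apply/funext => y; rewrite embE// mul1r.
  have embVE : (fun y => (complex.Re (emb V (fun=> 1) y))%:E) =
      (fun y => ((V y)%:num)%:E) by apply/funext => y; rewrite embE// mul1r.
  rewrite embVE in intV.
  (* Integrability makes the integral of [V] finite, so its real value is comparable with the
     extended one in [h1]. *)
  by rewrite embV /Rintegral -lee_fin fineK ?h1//; exact: integrable_fin_num.
apply: (@le_trans _ _ (real_op T (fun=> 1) x)).
  by apply: (posfun_le pT) => // y; have /andP[] := u01 y.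
apply: (le_trans T1); rewrite ler_wpDl ?le_max ?lexx//.
exact: (posfun_ge0 (posop_fun (posop_real_op mV posK) x)).
Qed.
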